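(* For every lattice polytope $P \subseteq \mathbf{R}^n$ there is a positive integer $\ell$ such that \[ h(\ell P \cap \mathbf{Z}^n) = (h \ell P) \cap \mathbf{Z}^n \] for every positive integer $h$.
   Context: A lattice polytope in $\mathbf{R}^n$ is the convex hull of a finite set of points of $\mathbf{Z}^n$. For $X \subseteq \mathbf{R}^n$ and a positive integer $h$, the $h$-fold sumset is $hX = \{x_1 + \cdots + x_h : x_i \in X \text{ for all } i = 1, \ldots, h\}$; if $X$ is convex, $hX$ equals the dilation $\{hx : x \in X\}$. Here $h(\ell P \cap \mathbf{Z}^n)$ is the $h$-fold sumset of the set $(\ell P) \cap \mathbf{Z}^n$, and $h\ell P = h(\ell P)$. *)

(* Defs.v *)
From mathcomp Require Import all_boot all_order all_algebra.
From mathcomp Require Import interval_inference.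
From mathcomp Require Import boolp classical_sets cardinality reals convex.

Set Implicit Arguments.
Unset Strict Implicit.
Unset Printing Implicit Defensive.

Import Order.TTheory GRing.Theory Num.Theory.
Local Open Scope classical_set_scope.
Local Open Scope ring_scope.

(* For h = 0 this is the singleton of 0. *)
Definition sumset (V : nmodType) (h : nat) (X : set V) : set V :=
  [set x | exists2 f : 'I_h -> V, (forall i, X (f i)) & x = \sum_i f i].

Definition Zn (R : realType) (n : nat) : set 'rV[R]_n :=
  [set x | x \is a mxOver Num.int].

(* [convex_set] is stated on the alias [convex_lmodType V] of [V]; the casts
   below only move between the two. *)
Definition convex_hull (R : realType) (V : lmodType R) (S : set V) : set V :=
  smallest (@convex_set R V) (S : set (convex_lmodType V)).

Definition lattice_polytope (R : realType) (n : nat) (P : set 'rV[R]_n) : Prop :=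
  exists S : set 'rV[R]_n, [/\ finite_set S, S `<=` @Zn R n & P = convex_hull S].

Lemma convex_hull_convex (R : realType) (V : lmodType R) (S : set V) :
  convex_set (convex_hull S : set (convex_lmodType V)).
Proof.
move=> x y k /set_mem hx /set_mem hy; apply/mem_set => A [cA SA].
by apply/set_mem/cA; apply/mem_set; [apply: hx | apply: hy].
Qed.

(* On convex sets the h-fold sumset is the dilation by h. *)
Lemma sumset_convex (R : realType) (V : lmodType R) (X : set V) (h : nat) :
  convex_set (X : set (convex_lmodType V)) -> (0 < h)%N ->
  sumset h X = [set h%:R *: x | x in X].
Proof.
move=> cX; case: h => // h _; apply/seteqP; split => [x [f fX ->]|_ [x Xx <-]].
- elim: h f fX => [|h IHh] f fX.
    by exists (f ord0); rewrite // scale1r big_ord1.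
  rewrite big_ord_recr /=.
  have [//|y Xy <-] := IHh (fun i => f (widen_ord (leqnSn _) i)).
  have h0 : h.+2%:R != 0 :> R by rewrite pnatr_eq0.
  have k01 : 0 <= (h.+1%:R / h.+2%:R : R) <= 1.
    by rewrite divr_ge0 //= ler_pdivrMr ?ltr0n // mul1r ler_nat.
  case/andP: k01 => k0 k1.
  exists (conv (Itv01 k0 k1) (y : convex_lmodType V) (f ord_max)).
    by apply/set_mem/cX; apply/mem_set.
  rewrite /conv /= scalerDr !scalerA mulrC divfK //; congr (_ + _).
  rewrite /unstable.onem mulrBr mulr1 mulrC divfK //.
  by rewrite -natrB // subSnn scale1r.
- by exists (fun=> x); rewrite // sumr_const card_ord scaler_nat.
Qed.

(* Main.v *)
Require Import Defs.
From mathcomp Require Import all_boot all_order all_algebra.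
From mathcomp Require Import boolp classical_sets cardinality reals convex.
From mathcomp Require Import interval_inference lra.

(** If [P] is spanned by finitely many lattice points [v i], then for [t > 0] the
    dilation [t P] consists of the vectors [\sum_i w i *: v i] with [w >= 0] and
    [\sum_i w i = t]; this is [hullE] together with [sumset_weighted_sums].  Any
    positive integer [l] that is at least the number of points [v i] works.

    The inclusion from left to right is immediate.  Conversely, let [x] be a
    lattice point of [h l P] with [h >= 2], say [x = \sum_i w i *: v i] with
    [\sum_i w i = h l >= l + l].  The weights are then so heavy that one can
    subtract 1 from some weight [w i >= 1], [l] times in a row: as long as the
    total weight exceeds the number of points, some weight exceeds 1
    ([natural_weights_below]).  The [l] points [v i] subtracted in this way sum to
    a lattice point of [l P], and what remains of [x] is a lattice point of
    [(h - 1) l P], so induction on [h] writes [x] as a sum of [h] lattice points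
    of [l P] ([lattice_point_decomposition]). *)

Set Implicit Arguments.
Unset Strict Implicit.
Unset Printing Implicit Defensive.

Import Order.TTheory GRing.Theory Num.Theory.
Local Open Scope classical_set_scope.
Local Open Scope ring_scope.

Lemma sumset1 (V : nmodType) (X : set V) (x : V) : X x -> sumset 1 X x.
Proof. by move=> Xx; exists (fun=> x); rewrite ?big_ord1. Qed.

Lemma sumsetS (V : nmodType) (h : nat) (X : set V) (x y : V) :
  X x -> sumset h X y -> sumset h.+1 X (x + y).
Proof.
move=> Xx [f fX ->]; exists (fun i => oapp f x (unlift ord0 i)).
  by move=> i; case: unliftP => [j|] _ /=; [apply: fX | apply: Xx].
rewrite big_ord_recl unlift_none /=; congr (_ + _).
by apply: eq_bigr => i _; rewrite liftK.
Qed.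

Lemma Zn_sum (R : realType) (n : nat) (I : finType) (f : I -> 'rV[R]_n) :
  (forall i, @Zn R n (f i)) -> @Zn R n (\sum_i f i).
Proof.
move=> fZ; apply/mxOverP => i j; rewrite summxE rpred_sum // => k _.
exact: (mxOverP (fZ k)).
Qed.

Lemma ZnB (R : realType) (n : nat) (x y : 'rV[R]_n) :
  @Zn R n x -> @Zn R n y -> @Zn R n (x - y).
Proof.
move=> /mxOverP xZ /mxOverP yZ; apply/mxOverP => i j.
by rewrite !mxE rpredB.
Qed.

Lemma ZnMn (R : realType) (n : nat) (x : 'rV[R]_n) (c : nat) :
  @Zn R n x -> @Zn R n (c%:R *: x).
Proof.
by move=> /mxOverP xZ; apply/mxOverP => i j; rewrite mxE rpredM ?rpred_nat.
Qed.

(** The sums of multiples [c *: a], with [a] in a convex set and [c >= 0], add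
    up along with their factors [c].  Keeping the total factor free, instead of
    normalising it to 1, lets finite sums be treated one term at a time. *)
Lemma convex_scaleD (R : realType) (V : lmodType R) (A : set V) (s t : R)
    (a b : V) :
  convex_set (A : set (convex_lmodType V)) -> 0 <= s -> 0 <= t -> A a -> A b ->
  exists2 c, A c & s *: a + t *: b = (s + t) *: c.
Proof.
move=> cA s0 t0 Aa Ab; have [st0|st0] := eqVneq (s + t) 0.
  exists a => //.
  have [-> ->] : s = 0 /\ t = 0 by split; lra.
  by rewrite addr0 !scale0r addr0.
have st_gt0 : 0 < s + t by rewrite lt_neqAle eq_sym st0 addr_ge0.
have k0 : 0 <= s / (s + t) by rewrite divr_ge0 // ltW.
have k1 : s / (s + t) <= 1 by rewrite ler_pdivrMr // mul1r lerDl.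
exists (conv (Itv01 k0 k1) (a : convex_lmodType V) b).
  by apply/set_mem/cA; apply/mem_set.
rewrite /conv /= scalerDr !scalerA mulrC divfK //; congr (_ + _).
by rewrite /unstable.onem mulrBr mulr1 mulrC divfK // [s + t]addrC addrK.
Qed.

(** For [t > 0] this is the dilation by [t] of the convex hull of the points
    [v i].  In terms of weights, Minkowski sums simply add the totals [t], and
    [t = 0] gives the neutral element, the singleton of 0, even for an empty
    family. *)
Definition weighted_sums (R : realType) (V : lmodType R) (I : finType)
    (v : I -> V) (t : R) : set V :=
  [set x | exists w : I -> R,
    [/\ forall i, 0 <= w i, \sum_i w i = t & x = \sum_i w i *: v i]].

Section WeightedSums.
Variables (R : realType) (V : lmodType R) (I : finType) (v : I -> V).

Local Notation W := (weighted_sums v).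

Lemma weighted_sums0 : W 0 0.
Proof.
by exists (fun=> 0); split=> [//||]; rewrite big1 // => i _; rewrite scale0r.
Qed.

Lemma weighted_sumsD (s t : R) (x y : V) : W s x -> W t y -> W (s + t) (x + y).
Proof.
move=> [w [w0 <- ->]] [u [u0 <- ->]]; exists (fun i => w i + u i); split.
- by move=> i; rewrite addr_ge0.
- by rewrite big_split.
- by rewrite -big_split; apply: eq_bigr => i _; rewrite scalerDl.
Qed.

Lemma weighted_sumsZ (c t : R) (x : V) : 0 <= c -> W t x -> W (c * t) (c *: x).
Proof.
move=> c0 [w [w0 <- ->]]; exists (fun i => c * w i); split.
- by move=> i; rewrite mulr_ge0.
- by rewrite mulr_sumr.
- by rewrite scaler_sumr; apply: eq_bigr => i _; rewrite scalerA.
Qed.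

Lemma weighted_sums_vertex (i : I) : W 1 (v i).
Proof.
exists (fun j => (j == i)%:R); split=> [j||]; first exact: ler0n.
  by rewrite (bigD1 i) //= eqxx big1 ?addr0 // => j /negPf->.
rewrite (bigD1 i) //= eqxx scale1r big1 ?addr0 // => j /negPf->.
by rewrite scale0r.
Qed.

Lemma weighted_sums_convex (t : R) :
  convex_set (W t : set (convex_lmodType V)).
Proof.
move=> x y k /set_mem Wx /set_mem Wy; apply/mem_set.
rewrite -[t]mul1r -(unstable.add_onemK k%:inum) mulrDl.
by apply: weighted_sumsD; apply: weighted_sumsZ => //; apply: unstable.onem_ge0.
Qed.

Lemma sumset_weighted_sums (h : nat) (t : R) : (0 < h)%N ->
  sumset h (W t) = W (h%:R * t).
Proof.
move=> h0; have hN0 : h%:R != 0 :> R by rewrite pnatr_eq0 -lt0n.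
apply/seteqP; split=> [x [f fW ->]|x Wx].
  have -> : h%:R * t = \sum_(i < h) t by rewrite sumr_const card_ord mulr_natl.
  apply: (big_ind2 (fun x s => W s x)) => //; first exact: weighted_sums0.
  by move=> *; apply: weighted_sumsD.
exists (fun=> h%:R^-1 *: x) => [_|].
  by rewrite -[t](mulKf hN0); apply: weighted_sumsZ; rewrite ?invr_ge0 ?ler0n.
by rewrite sumr_const card_ord -scaler_nat scalerA divff // scale1r.
Qed.

Lemma hullE : convex_hull (range v) = W 1.
Proof.
apply/seteqP; split.
  apply: smallest_sub; first exact: weighted_sums_convex.
  by move=> _ [i _ <-]; apply: weighted_sums_vertex.
move=> x [w [w0 w1 ->]] A [cA vA].
have [i0 _] : exists i : I, True.
  apply/not_existsP => I0; have /eqP := w1.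
  by rewrite big1 1?eq_sym ?oner_eq0 // => i; have := I0 i.
suff [_ [a Aa ->]] : 0 <= \sum_i w i /\
    exists2 a, A a & \sum_i w i *: v i = (\sum_i w i) *: a.
  by rewrite w1 scale1r.
apply: (big_ind2 (fun (y : V) (s : R) => 0 <= s /\ exists2 a, A a & y = s *: a)).
- by split=> //; exists (v i0); rewrite ?scale0r //; apply: vA; exists i0.
- move=> _ s _ t [s0 [a Aa ->]] [t0 [b Ab ->]]; split; first exact: addr_ge0.
  exact: convex_scaleD.
- by move=> i _; split=> //; exists (v i) => //; apply: vA; exists i.
Qed.

(** Pigeonhole: while the weights not yet used up exceed [#|I|] in total, one of
    them exceeds 1 and can give up one more unit. *)
Lemma natural_weights_below (w : I -> R) (l : nat) :
  (forall i, 0 <= w i) -> (l + #|I|)%:R <= \sum_i w i ->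
  exists c : I -> nat, (forall i, (c i)%:R <= w i) /\ (\sum_i c i = l)%N.
Proof.
move=> w0; elim: l => [|l IHl] wl.
  by exists (fun=> 0%N); rewrite big1.
have [|c [cw cl]] := IHl; first by apply: le_trans wl; rewrite ler_nat addSn.
have [i wi] : exists i, 1 <= w i - (c i)%:R.
  apply/not_existsP => wc.
  have : \sum_i (w i - (c i)%:R) <= \sum_(i : I) 1.
    by apply: ler_sum => i _; have /negP := wc i; rewrite -ltNge => /ltW.
  rewrite sumrB -natr_sum cl sumr_const; apply/negP.
  rewrite -ltNge ltrBrDl -natrD.
  by apply: lt_le_trans wl; rewrite ltr_nat addSn.
exists (fun j => (c j + (j == i))%N); split=> [j|].
  have [->|_] := eqVneq j i; last by rewrite addn0.
  by rewrite natrD addrC -lerBrDr.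
rewrite big_split /= cl (bigD1 i) //= eqxx big1 ?addn1 //.
by move=> j /negPf->.
Qed.

End WeightedSums.

(** The integer decomposition property of [l P].  For [h >= 2] the total weight
    [h * l] is at least [l + #|I|], which is what it takes to split off a
    summand made of [l] of the points [v i]; the remainder has total weight
    [(h - 1) * l] and is again a lattice point. *)
Lemma lattice_point_decomposition (R : realType) (n : nat) (I : finType)
    (v : I -> 'rV[R]_n) (l h : nat) (x : 'rV[R]_n) :
  (forall i, @Zn R n (v i)) -> (#|I| <= l)%N -> (0 < h)%N ->
  weighted_sums v (h%:R * l%:R) x -> @Zn R n x ->
  sumset h (weighted_sums v l%:R `&` @Zn R n) x.
Proof.
move=> vZ Il; case: h => // h _; elim: h x => [|h IHh] x.
  by rewrite mul1r => Wx Zx; apply: sumset1.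
move=> [w [w0 wS ->]] xZ.
have [|c [cw cl]] := @natural_weights_below R I w l w0.
  rewrite wS -natrM ler_nat; apply: (@leq_trans (l + l)).
    by rewrite leq_add2l.
  by rewrite addnn -mul2n leq_mul2r orbT.
pose y := \sum_i (c i)%:R *: v i.
have yZ : @Zn R n y.
  by apply: Zn_sum => i; apply: ZnMn.
have yW : weighted_sums v l%:R y.
  by exists (fun i => (c i)%:R); rewrite -natr_sum cl.
rewrite -[\sum_i _](subrKC y); apply: sumsetS => //; apply: IHh.
  exists (fun i => w i - (c i)%:R); split=> [i||].
  - by rewrite subr_ge0.
  - by rewrite sumrB wS -natr_sum cl -[h.+2]addn1 natrD mulrDl mul1r addrK.
  - by rewrite -sumrB; apply: eq_bigr => i _; rewrite scalerBl.
exact: ZnB.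
Qed.

Theorem theorem2 (R : realType) (n : nat) (P : set 'rV[R]_n)
    (hP : lattice_polytope P) :
  exists l : nat, (0 < l)%N /\
    forall h : nat, (0 < h)%N ->
      sumset h (sumset l P `&` @Zn R n) = sumset h (sumset l P) `&` @Zn R n.
Proof.
have [_ [/finite_seqP[s ->] sZ ->]] := hP.
pose v (i : 'I_(size s)) := s`_i.
have sE : [set` s] = range v.
  apply/seteqP; split=> [x /= xs|_ [i _ <-]]; last exact: mem_nth.
  have si : (index x s < size s)%N by rewrite index_mem.
  by exists (Ordinal si); rewrite // /v nth_index.
have vZ i : @Zn R n (v i) by apply: sZ; apply: mem_nth.
(* The successor keeps [l] positive when [P] is empty. *)
exists (size s).+1; split=> // h h0.
rewrite sE hullE sumset_weighted_sums // mulr1.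
apply/seteqP; split=> [x [f fX xE]|x [Wx Zx]].
  split; first by exists f => // i; case: (fX i).
  by rewrite xE; apply: Zn_sum => i; case: (fX i).
rewrite sumset_weighted_sums // in Wx.
by apply: lattice_point_decomposition => //; rewrite card_ord.
Qed.
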